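(* Let $K/\mathbb{Q}$ be a finite Galois extension. For $\mathbf{r}\in K_\infty$ and $F=\sum_{\alpha\in K}a_\alpha\boldsymbol\varrho^\alpha\in{\sf H}_\bullet[K]$ put $$\Phi_{\mathbf r}(F)=\sum_{\alpha\in K}a_\alpha\exp\big(2\pi i\,{\sf Tr}(\alpha\mathbf r)\big)\boldsymbol\varrho^\alpha ,$$ which gives a representation $\Phi:K_\infty\to{\sf U}({\sf H}_\bullet[K])$ by unitary operators. Then the projectivization $[\Phi]$ of $\Phi$ defines a monomorphism $$[\Phi]:K_\infty\hookrightarrow{\sf Gal}_\oplus\big(\bar{\sf N}_\bullet[K]/K\big).$$
   Context: **$K_\infty$.** $K_\infty=\{(z_\nu)\in\mathbb{C}^{d}:\bar z_\nu=z_{\bar\nu}\}$, indexed by the $d=[K:\mathbb{Q}]$ embeddings $\nu$ of $K$ in $\mathbb{C}$, an additive group and ring under coordinatewise operations; $K\subset K_\infty$ by $\alpha\mapsto(\nu(\alpha))_\nu$; ${\sf Tr}(\mathbf z)=\sum_\nu z_\nu\in\mathbb{R}$. **Hilbert space.** $\mathbb{S}_K=\mathbb{A}_K/(K,+)$ is the adele class group, a compact abelian group with unit mass Haar measure; its characters $\phi_\alpha$ are canonically indexed by $\alpha\in K$, with $\phi_\alpha\phi_\beta=\phi_{\alpha+\beta}$. Every $f\in L^2(\mathbb{S}_K,\mathbb{C})$ is $f=\sum_{\alpha\in K}a_\alpha\phi_\alpha$ with $(a_\alpha)\in\ell^2(K)$. The Hilbert space ${\sf H}_\bullet[K]$ of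 graded-holomorphic functions is identified isometrically, by taking boundary values, with $L^2(\mathbb{S}_K,\mathbb{C})\cong\ell^2(K)$; its elements are written $F=\sum_{\alpha\in K}a_\alpha\boldsymbol\varrho^\alpha$, where $\boldsymbol\varrho^\alpha$ has boundary value $\phi_\alpha$. **Grading.** $K$ is totally real or totally complex. If totally real, the sign of $\alpha\in K\setminus\{0\}$ is the vector of signs $\pm$ of its images under the real places. If totally complex, choose one embedding $\mu$ from each complex conjugate pair; the sign of $\alpha\neq 0$ is the vector, indexed by the chosen $\mu$, recording which of the following eight pieces of $\mathbb{C}\setminus\{0\}$ contains $\mu(\alpha)$: the four open half-axes $\mathbb{R}_+,i\mathbb{R}_+,-\mathbb{R}_+,-i\mathbb{R}_+$ or the four open quadrants. Let $\mho_K$ be the set of sign vectors (in the complex case, those realized by elements of $K$) and ${\sf H}_{\boldsymbol\vartheta}[K]$ the closed subspace of series supported on elements of sign $\boldsymbol\vartheta$; ${\sf H}_\bullet[K]=\big(\bigoplus_{\boldsymbol\vartheta}{\sf H}_{\boldsymbol\vartheta}[K]\big)\oplus\mathbb{C}$, the last summand being the constants $\mathbb{C}\boldsymbol\varrho^0$. **Cauchy product.** For $F=\sum a_\alpha\boldsymbol\varrho^\alpha$, $G=\sum b_\alpha\boldsymbol\varrho^\alpha$, $F\oplus G=\sum_\alpha\big(\sum_{\alpha_1+\alpha_2=\alpha}a_{\alpha_1}b_{\alpha_2}\big)\boldsymbol\varrho^\alpha$, defined when the coefficient sequence lies in $\ell^2(K)$. **Galois group.** $\bar{\sf N}_\bullet[K]=\mathbb{P}{\sf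 H}_\bullet[K]$ is the full projectivization, with the Fubini–Study metric and the induced partially defined operation $\oplus$ on classes $[F]$. ${\sf Gal}_\oplus(\bar{\sf N}_\bullet[K]/K)$ is the group of bijective graded Fubini–Study isometries $\Upsilon$ of $\bar{\sf N}_\bullet[K]$ (graded: for some permutation $\iota$ of $\mho_K$, $\Upsilon(\mathbb{P}{\sf H}_{\boldsymbol\vartheta}[K])=\mathbb{P}{\sf H}_{\iota(\boldsymbol\vartheta)}[K]$ for all $\boldsymbol\vartheta$) that fix $[\boldsymbol\varrho^\alpha]$ for every $\alpha\in K$ and satisfy $\Upsilon([F]\oplus[G])=\Upsilon([F])\oplus\Upsilon([G])$ whenever the operation is defined. *)

(* Defs.v *)
From HB Require Import structures.
From mathcomp Require Import all_boot all_order all_algebra all_field complex.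
From mathcomp Require Import boolp classical_sets functions cardinality fsbigop.
From mathcomp Require Import reals ereal esum topology normedtype sequences exp trigo.
From mathcomp Require Import ring.
From mathcomp.analysis.showcase Require summability.

Set Implicit Arguments.
Unset Strict Implicit.
Unset Printing Implicit Defensive.

Import Order.TTheory GRing.Theory Num.Theory numFieldNormedType.Exports.
Import ComplexField.Normc.

Local Open Scope classical_set_scope.
Local Open Scope ring_scope.
Local Open Scope complex_scope.

Section Embeddings.
Variables (R : realType) (K : fieldExtType rat).

Definition emb := {rmorphism K -> R[i]}.

HB.instance Definition _ := gen_eqMixin emb.
HB.instance Definition _ := gen_choiceMixin emb.

Lemma emb_eqP (nu mu : emb) : nu =1 mu -> nu = mu.
Proof.
case: nu mu => [f cf] [g cg] /= /funext fg; move: cf cg; rewrite fg => cf cg.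
congr GRing.RMorphism.Pack; case: cf cg => [[a] [b]] [[c] [d]].
by rewrite (Prop_irrelevance a c) (Prop_irrelevance b d).
Qed.

Lemma emb_poly1 (nu mu : emb) (p : {poly K}) :
  p \is a polyOver 1%VS -> map_poly nu p = map_poly mu p.
Proof.
move=> /polyOverP p1; apply/polyP => i; rewrite !coef_map.
by have /vlineP[a ->] := p1 i; rewrite /= !rmorphZ_num !rmorph1.
Qed.

Lemma emb_finite : exists (T : finType) (f : emb -> T), injective f.
Proof.
have [[nu0 _]|no] := pselect (exists nu : emb, True); last first.
  exists void, (fun nu => False_rect void (no (ex_intro _ nu I))).
  by move=> nu; case: no; exists nu.
pose b := vbasis {:K}; pose P i := map_poly nu0 (minPoly 1 b`_i).
have P0 i : P i != 0 by rewrite map_poly_eq0 monic_neq0 // monic_minPoly.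
pose rs i := sval (closed_field_poly_normal (P i)).
have rsP i (nu : emb) : nu b`_i \in rs i.
  have : root (P i) (nu b`_i).
    rewrite /P (@emb_poly1 nu0 nu) ?minPolyOver // fmorph_root.
    exact: root_minPoly.
  rewrite [P i](svalP (closed_field_poly_normal (P i))).
  by rewrite rootZ ?lead_coef_eq0 // root_prod_XsubC.
pose s := flatten [seq rs i | i <- iota 0 (\dim {:K})].
have sP (i : 'I_(\dim {:K})) (nu : emb) : nu b`_i \in s.
  apply/flatten_mapP; exists (val i); last exact: rsP.
  by rewrite mem_iota /= add0n ltn_ord.
exists {ffun 'I_(\dim {:K}) -> seq_sub s}.
exists (fun nu => [ffun i => SeqSub (sP i nu)]) => nu mu /ffunP E.
apply: emb_eqP => x; rewrite (coord_vbasis (memvf x)) !rmorph_sum /=.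
apply: eq_bigr => i _; rewrite !rmorphZ_num; congr (_ * _).
by have := E i; rewrite !ffunE => /(congr1 val).
Qed.

Let emb_T : finType := sval (cid emb_finite).
Let emb_f : emb -> emb_T := sval (cid (svalP (cid emb_finite))).
Let emb_g (t : emb_T) : option emb :=
  if pselect (exists nu, emb_f nu = t) is left h then Some (sval (cid h))
  else None.

Lemma emb_fK : pcancel emb_f emb_g.
Proof.
move=> nu; rewrite /emb_g; case: pselect => [h|[]]; last by exists nu.
by congr Some; exact: (svalP (cid (svalP (cid emb_finite)))) (svalP (cid h)).
Qed.

HB.instance Definition _ := PCanIsCountable emb_fK.
HB.instance Definition _ : isFinite emb := PCanIsFinite emb_fK.

Definition conj_emb (nu : emb) : emb := (conjc \o nu : {rmorphism K -> R[i]}).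

Lemma conj_embK : involutive conj_emb.
Proof. by move=> nu; apply: emb_eqP => x; rewrite /= conjcK. Qed.

End Embeddings.

Section Kinf.
Variables (R : realType) (K : fieldExtType rat).

(* Kinf is the subring of C^emb cut out by the conjugation condition; its ring
   operations are inherited coordinatewise. *)
Definition Kinf_pred : {pred emb R K -> R[i]} :=
  [pred z : emb R K -> R[i] | [forall nu, conjc (z nu) == z (conj_emb nu)]].

Lemma Kinf_closed : subring_closed Kinf_pred.
Proof.
split=> [|x y|x y]; rewrite ?inE.
- by apply/forallP => nu; rewrite rmorph1.
- move=> /forallP hx /forallP hy; apply/forallP => nu.
  by rewrite !fctE rmorphB /= (eqP (hx nu)) (eqP (hy nu)).
- move=> /forallP hx /forallP hy; apply/forallP => nu.
  by rewrite !fctE rmorphM /= (eqP (hx nu)) (eqP (hy nu)).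
Qed.

HB.instance Definition _ := GRing.isSubringClosed.Build _ Kinf_pred Kinf_closed.

Record Kinf := MkKinf {
  Kinf_val :> emb R K -> R[i];
  Kinf_valP : Kinf_val \in Kinf_pred }.

HB.instance Definition _ := [isSub for Kinf_val].
HB.instance Definition _ := [Choice of Kinf by <:].
HB.instance Definition _ := 
  GRing.SubChoice_isSubComPzRing.Build _ _ Kinf Kinf_closed.

Lemma Kdiag_subproof (alpha : K) :
  (fun nu : emb R K => nu alpha) \in Kinf_pred.
Proof. by apply/forallP => nu; exact: eqxx. Qed.

(* the diagonal inclusion of K in Kinf *)
Definition Kdiag (alpha : K) : Kinf := MkKinf (Kdiag_subproof alpha).

(* The sum of the coordinates is real (TrE), so taking its real part only
   changes its type from R[i] to R. *)
Definition Tr (z : Kinf) : R := complex.Re (\sum_nu z nu).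

Lemma TrE (z : Kinf) : (Tr z)%:C = \sum_nu z nu.
Proof.
rewrite /Tr; set s := \sum_nu _; suff : conjc s = s.
  by case: s => a b [] /esym/eqP; rewrite -addr_eq0 -mulr2n mulrn_eq0 => /eqP ->.
rewrite {1}/s rmorph_sum /= (reindex_inj (inv_inj (@conj_embK R K))).
apply: eq_bigr => nu _; case: z {s} => z /= /forallP/(_ (conj_emb nu))/eqP ->.
by rewrite conj_embK.
Qed.

End Kinf.

Section Ell2.
Variables (R : realType) (K : fieldExtType rat).

(* The Hilbert space is modelled by l^2(K): a series F = \sum_x a_x rho^x is
   given by its coefficient function a, so that F x is the coefficient of
   rho^x in F. *)
Definition ell2_pred : {pred K -> R[i]} :=
  [pred a : K -> R[i] |
    (\esum_(x in [set: K]) (normc (a x) ^+ 2)%:E < +oo)%E].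

Lemma esumZ (k : R) (f : K -> R) : 0 <= k -> (forall x, 0 <= f x) ->
  (\esum_(x in [set: K]) (k * f x)%:E =
   k%:E * \esum_(x in [set: K]) (f x)%:E)%E.
Proof.
move=> k0 f0; rewrite /esum -ereal_supZl //; last first.
  by apply/set0P; exists 0%E, set0; [split|rewrite fsbig_set0].
rewrite image_comp; congr ereal_sup; apply: eq_imagel => A _ /=.
by under eq_fsbigr do rewrite EFinM; rewrite -ge0_mule_fsumr // => x; rewrite lee_fin.
Qed.

Lemma esum_ltyZ (k : R) (f : K -> R) : 0 <= k -> (forall x, 0 <= f x) ->
  (\esum_(x in [set: K]) (f x)%:E < +oo)%E ->
  (\esum_(x in [set: K]) (k * f x)%:E < +oo)%E.
Proof.
move=> k0 f0 hf; rewrite esumZ //; set S := esum _ _ in hf *.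
have S0 : (0 <= S)%E by apply: esum_ge0 => x _; rewrite lee_fin.
by rewrite -ge0_fin_numE ?mule_ge0 // fin_numM // ge0_fin_numE.
Qed.

Lemma normc_ge0 (z : R[i]) : 0 <= normc z.
Proof. by case: z => a b; exact: sqrtr_ge0. Qed.

Lemma ell2_closed : submod_closed ell2_pred.
Proof.
split=> [|k a b]; rewrite ?inE.
  by rewrite esum1 // => x _; rewrite [0 x]/(0 : R[i]) normc0 expr0n.
move=> ha hb; pose f x : \bar R := (2 * normc k ^+ 2 * normc (a x) ^+ 2)%:E.
pose g x : \bar R := (2 * normc (b x) ^+ 2)%:E.
apply: (@le_lt_trans _ _ (\esum_(x in [set: K]) (f x + g x))%E).
  apply: le_esum => x _; rewrite /f /g -EFinD lee_fin !fctE.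
  set p := normc k * normc (a x); set q := normc (b x).
  have pq : normc (k *: a x + b x) <= p + q.
    by apply: le_trans (le_normcD _ _) _; rewrite /p /q -normcM.
  apply: (@le_trans _ _ ((p + q) ^+ 2)).
    by rewrite ler_sqr ?nnegrE ?normc_ge0 ?addr_ge0 ?mulr_ge0 ?normc_ge0.
  rewrite -mulrA -exprMn -/p -subr_ge0.
  suff -> : 2 * p ^+ 2 + 2 * q ^+ 2 - (p + q) ^+ 2 = (p - q) ^+ 2 by apply: sqr_ge0.
  by ring.
rewrite esumD; first 1 last.
- by move=> x _; rewrite lee_fin mulr_ge0 ?sqr_ge0 // mulr_ge0 ?sqr_ge0 ?ler0n.
- by move=> x _; rewrite lee_fin mulr_ge0 ?sqr_ge0 ?ler0n.
apply: lte_add_pinfty; apply: esum_ltyZ => //.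
all: try by move=> x; exact: sqr_ge0.
by rewrite mulr_ge0 ?sqr_ge0 ?ler0n.
Qed.

HB.instance Definition _ := GRing.isSubmodClosed.Build _ _ ell2_pred ell2_closed.

Record ell2 := MkEll2 {
  coef :> K -> R[i];
  coefP : coef \in ell2_pred }.

HB.instance Definition _ := [isSub for coef].
HB.instance Definition _ := [Choice of ell2 by <:].
HB.instance Definition _ := [SubChoice_isSubLmodule of ell2 by <:].

End Ell2.

Section Bijections.
Variable T : Type.

Record bijection := MkBijection {
  bij_fun :> T -> T;
  bij_bij : bijective bij_fun }.

HB.instance Definition _ := gen_eqMixin bijection.
HB.instance Definition _ := gen_choiceMixin bijection.

Lemma bijection_eqP (f g : bijection) : f =1 g -> f = g.
Proof.
case: f g => [f f_bij] [g g_bij] /= /funext fg; move: f_bij g_bij.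
by rewrite fg => f_bij g_bij; rewrite (Prop_irrelevance f_bij g_bij).
Qed.

Definition bij_one := 
  @MkBijection id (Bijective (fun=> erefl) (fun=> erefl)).
Definition bij_mul (f g : bijection) := MkBijection (bij_comp (bij_bij f) (bij_bij g)).

Lemma bij_inv_subproof (f : bijection) :
  exists g : bijection, cancel f g /\ cancel g f.
Proof. by case: f => f [g fK gK]; exists (MkBijection (Bijective gK fK)). Qed.

Definition bij_inv (f : bijection) := sval (cid (bij_inv_subproof f)).

Lemma bij_invK (f : bijection) : cancel f (bij_inv f).
Proof. by case: (svalP (cid (bij_inv_subproof f))). Qed.

Lemma bij_invKV (f : bijection) : cancel (bij_inv f) f.
Proof. by case: (svalP (cid (bij_inv_subproof f))). Qed.

Fact bij_mulA : associative bij_mul.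
Proof. by move=> f g h; exact: bijection_eqP. Qed.
Fact bij_mul1 : left_id bij_one bij_mul.
Proof. by move=> f; exact: bijection_eqP. Qed.
Fact bij_1mul : right_id bij_one bij_mul.
Proof. by move=> f; exact: bijection_eqP. Qed.
Fact bij_mulV : left_inverse bij_one bij_inv bij_mul.
Proof. by move=> f; apply: bijection_eqP => x; exact: bij_invK. Qed.
Fact bij_Vmul : right_inverse bij_one bij_inv bij_mul.
Proof. by move=> f; apply: bijection_eqP => x; exact: bij_invKV. Qed.

HB.instance Definition _ := isGroup.Build bijection
  bij_mulA bij_mul1 bij_1mul bij_mulV bij_Vmul.

End Bijections.

Section Hilbert.
Variables (R : realType) (K : fieldExtType rat).
Local Notation H := (ell2 R K).

(* Unconditional sum over K: the limit of the finite partial sums along the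
   directed set of finite subsets of K. All the families summed below are
   products of two square-summable families, hence absolutely summable. *)
Definition csum (f : K -> R[i]) : R[i] := summability.sum (f : K -> R[i]^o).

Lemma csumZ (c : R[i]) (f : K -> R[i]) : csum (fun x => c * f x) = c * csum f.
Proof.
pose u := summability.partial_sum (f : K -> R[i]^o).
rewrite /csum /summability.sum (_ : summability.partial_sum _ = c \*: u).
  have PF := @summability.totally_filter K.
  suff : lim (c \*: u @ summability.totally) =
    (c : R[i]) *: lim (u @ summability.totally) :> R[i]^o by [].
  have [->|c0] := eqVneq c 0.
    rewrite scale0r (_ : 0 \*: u = cst 0).
      by apply: norm_cvg_lim; exact: cvg_cst.
    by apply/funext => A /=; rewrite scale0r.
  have [ucvg|udvg] := pselect (cvg (u @ summability.totally)); first exact: limZr.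
  rewrite (dvgP udvg) dvgP; first by rewrite [point](_ : _ = 0) // scaler0.
  by rewrite is_cvgZlE.
by apply/funext => A; rewrite /u /summability.partial_sum /= scaler_sumr.
Qed.

Definition inner (F G : H) : R[i] := csum (fun x => F x * conjc (G x)).

Definition hnorm (F : H) : R :=
  Num.sqrt (fine (\esum_(x in [set: K]) (normc (F x) ^+ 2)%:E)).

Lemma hnormZ (c : R[i]) (F : H) : hnorm (c *: F) = normc c * hnorm F.
Proof.
rewrite /hnorm; under eq_esum => x _.
  rewrite (_ : normc _ ^+ 2 = normc c ^+ 2 * normc (F x) ^+ 2).
  over. by rewrite normcM exprMn.
rewrite esumZ ?sqr_ge0 //; last by move=> x; exact: sqr_ge0.
rewrite fineM //; last first.
  rewrite ge0_fin_numE; first by have := coefP F; rewrite inE.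
  by apply: esum_ge0 => x _; rewrite lee_fin sqr_ge0.
by rewrite sqrtrM ?sqr_ge0 //= sqrtr_sqr ger0_norm // normc_ge0.
Qed.

Lemma innerZ (c d : R[i]) (F G : H) :
  inner (c *: F) (d *: G) = c * conjc d * inner F G.
Proof.
rewrite /inner -csumZ; congr csum; apply/funext => x /=.
by transitivity ((c * F x) * conjc (d * G x)); rewrite // rmorphM /= mulrACA.
Qed.

Definition unitary_pred : {pred bijection H} :=
  [pred u : bijection H |
    `[< linear u /\ forall F G, inner (u F) (u G) = inner F G >]].

Lemma unitary_closed : group_closed unitary_pred.
Proof.
split=> [|u v]; rewrite ?inE; first by [].
move=> [lu iu] [lv iv]; have vK := bij_invKV v.
have iV F G : inner (bij_inv v F) (bij_inv v G) = inner F G.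
  by rewrite -iv !vK.
split=> [a F G /=|F G /=]; last by rewrite iu iV.
rewrite -lu; congr (u _); apply: (can_inj (bij_invK v)).
by rewrite lv !vK.
Qed.

Record unitary := MkUnitary {
  unitary_val :> bijection H;
  unitaryP : unitary_val \in unitary_pred }.

HB.instance Definition _ := [isSub for unitary_val].
HB.instance Definition _ := [Choice of unitary by <:].
HB.instance Definition _ := SubChoice_isSubGroup.Build _ _ unitary unitary_closed.

(* complex exponential *)
Definition cexp (z : R[i]) : R[i] :=
  (expR (complex.Re z))%:C * (cos (complex.Im z) +i* sin (complex.Im z)).

Lemma normc_cexpi (t : R) : normc (cexp (t%:C * 'i%C)) = 1.
Proof.
rewrite /cexp /= !mul0r mulr0 mulr1 subrr addr0 expR0 mul1r.
by rewrite subr0 addr0 mul1r cos2Dsin2 sqrtr1.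
Qed.

Definition expTr (r : Kinf R K) (x : K) : R[i] :=
  cexp ((2 * pi * Tr (Kdiag R x * r))%:C * 'i%C).

Lemma Phi_subproof (r : Kinf R K) (F : H) :
  (fun x => F x * expTr r x) \in @ell2_pred R K.
Proof.
rewrite inE; have := coefP F; rewrite inE; congr (_ < _)%E.
by apply: eq_esum => x _; rewrite normcM normc_cexpi mulr1.
Qed.

Definition Phi (r : Kinf R K) (F : H) : H := MkEll2 (Phi_subproof r F).

Lemma rho_subproof (x : K) : (fun y => (y == x)%:R) \in @ell2_pred R K.
Proof.
rewrite inE (_ : (fun _ => _) = fun y => if y \in [set x] then 1%E else 0%E).
  by rewrite -esum_mkcond esum_set1 // ltry.
apply/funext => y; have [->|yx] := eqVneq y x.
  by rewrite normc1 expr1n mem_set.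
by rewrite normc0 expr0n memNset //= => /eqP; apply/negP.
Qed.

Definition rho (x : K) : H := MkEll2 (rho_subproof x).

Lemma rho_neq0 (x : K) : rho x != 0.
Proof.
apply/eqP => /(congr1 (fun F : H => F x)).
by rewrite /= eqxx; apply/eqP; rewrite oner_eq0.
Qed.

(* The pairs (x1, x2) with x1 + x2 = x are parametrised by y = x1. *)
Definition cauchy_coef (F G : H) (x : K) : R[i] :=
  csum (fun y => F y * G (x - y)).

Lemma cauchy_coefZ (c d : R[i]) (F G : H) :
  cauchy_coef (c *: F) (d *: G) = (c * d) *: cauchy_coef F G.
Proof.
apply/funext => x; transitivity ((c * d) * cauchy_coef F G x); last by [].
rewrite /cauchy_coef -csumZ; congr csum; apply/funext => y.
by transitivity ((c * F y) * (d * G (x - y))); rewrite // mulrACA.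
Qed.

(* partial: None when the coefficient family is not square-summable *)
Definition cauchy_prod (F G : H) : option H := insub (cauchy_coef F G).

End Hilbert.

Section Projective.
Variables (R : realType) (K : fieldExtType rat).
Local Notation H := (ell2 R K).

Definition nzvec := {F : H | F != 0}.

Definition proj_rel (F G : nzvec) : bool :=
  `[< exists2 c : R[i], c != 0 & val F = c *: val G >].

Lemma proj_rel_refl : reflexive proj_rel.
Proof. by move=> F; apply/asboolP; exists 1; rewrite ?oner_eq0 ?scale1r. Qed.

Lemma proj_rel_sym : symmetric proj_rel.
Proof.
suff s F G : proj_rel F G -> proj_rel G F by move=> F G; apply/idP/idP; exact: s.
move=> /asboolP[c c0 FG]; apply/asboolP; exists c^-1; first by rewrite invr_eq0.
by rewrite FG scalerA mulVf // scale1r.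
Qed.

Lemma proj_rel_trans : transitive proj_rel.
Proof.
move=> G F E /asboolP[c c0 FG] /asboolP[d d0 GE]; apply/asboolP.
by exists (c * d); rewrite ?mulf_neq0 // FG GE scalerA.
Qed.

Canonical proj_equiv :=
  EquivRel proj_rel proj_rel_refl proj_rel_sym proj_rel_trans.

(* P(H): nonzero vectors modulo nonzero scalars *)
Definition PH := {eq_quot proj_equiv}%qT.

HB.instance Definition _ := Choice.on PH.
HB.instance Definition _ := EqQuotient.on PH.

Definition cls (F : nzvec) : PH := (\pi_PH F)%qT.

Lemma clsP (F G : nzvec) :
  cls F = cls G <-> exists2 c : R[i], c != 0 & val F = c *: val G.
Proof.
split; first by move=> /eqmodP/asboolP.
by move=> h; apply/eqmodP/asboolP.
Qed.

Lemma repr_clsP (F : nzvec) :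
  exists2 c : R[i], c != 0 & val (repr (cls F)) = c *: val F.
Proof. by apply/clsP; rewrite /cls reprK. Qed.

(* Fubini-Study distance; by FS_cls it does not depend on representatives. *)
Definition FS (x y : PH) : R :=
  let F := val (repr x) in let G := val (repr y) in
  acos (normc (inner F G) / (hnorm F * hnorm G)).

(* The partial operation on classes: defined when the product of representatives
   is square-summable and nonzero, so that it has a class; by proj_cauchy_cls
   it does not depend on representatives. *)
Definition proj_cauchy (x y : PH) : option PH :=
  omap cls (obind insub (cauchy_prod (val (repr x)) (val (repr y)))).

Definition proj_rho (x : K) : PH := cls (exist _ (rho R x) (rho_neq0 R x)).

Lemma FS_cls (F G : nzvec) :
  FS (cls F) (cls G) =
  acos (normc (inner (val F) (val G)) / (hnorm (val F) * hnorm (val G))).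
Proof.
rewrite /FS; have [c c0 ->] := repr_clsP F; have [d d0 ->] := repr_clsP G.
have nJ (z : R[i]) : normc (conjc z) = normc z by case: z => p q; rewrite /= sqrrN.
rewrite innerZ !hnormZ !normcM nJ [X in _ / X]mulrACA -mulf_div divff ?mul1r //.
by rewrite mulf_neq0 //; apply/eqP => /eq0_normc/eqP; apply/negP.
Qed.

Lemma proj_cauchy_cls (F G : nzvec) :
  proj_cauchy (cls F) (cls G) =
  omap cls (obind insub (cauchy_prod (val F) (val G))).
Proof.
rewrite /proj_cauchy; have [c c0 ->] := repr_clsP F.
have [d d0 ->] := repr_clsP G; rewrite /cauchy_prod cauchy_coefZ.
have cd0 : c * d != 0 by rewrite mulf_neq0.
move: (cauchy_coef _ _) (c * d) cd0 => f k k0 {c d c0 d0}.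
case: insubP => [E Ef Ev|nf]; case: insubP => [E' Ef' Ev'|nf'] //=; last first.
- by case/negP: nf; rewrite rpredZ.
- case/negP: nf'; rewrite -[f]scale1r -(mulVf k0) -scalerA rpredZ //.
have {Ev Ev'} EE : E = k *: E' by apply: val_inj; rewrite Ev /= -[in LHS]Ev'.
case: insubP => [v En0 vE|E0]; case: insubP => [v' En0' vE'|E0'] //=.
- by congr Some; apply/clsP; exists k; rewrite // vE vE'.
- by case/negP: E0'; apply: contra_neq En0 => E0'; rewrite EE E0' scaler0.
- by case/negP: E0; rewrite EE scaler_eq0 negb_or k0.
Qed.

Lemma unitary0 (u : unitary R K) : u 0 = 0.
Proof.
have /asboolP[lu _] := unitaryP u.
by have := lu (-1) 0 0; rewrite scaler0 add0r scaleN1r addNr.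
Qed.

Lemma unitary_neq0 (u : unitary R K) (F : nzvec) : u (val F) != 0.
Proof.
apply: contra_neq (valP F) => uF0.
by apply: (bij_inj (bij_bij u)); rewrite uF0 unitary0.
Qed.

Definition unitary_nz (u : unitary R K) (F : nzvec) : nzvec :=
  exist _ (u (val F)) (unitary_neq0 u F).

Definition projectivize (u : unitary R K) (x : PH) : PH :=
  cls (unitary_nz u (repr x)).

Lemma projectivizeE (u : unitary R K) (F : nzvec) :
  projectivize u (cls F) = cls (unitary_nz u F).
Proof.
apply/clsP; have [c c0 E] := repr_clsP F; exists c => //=.
rewrite E; have /asboolP[lu _] := unitaryP u.
by have := lu c (val F) 0; rewrite !addr0 unitary0 addr0.
Qed.

End Projective.

Section GaloisGroup.
Variables (R : realType) (K : fieldExtType rat) (S : {set emb R K}).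

Definition totally_real : Prop :=
  forall (nu : emb R K) (x : K), complex.Im (nu x) = 0.

Definition totally_complex : Prop :=
  forall nu : emb R K, exists x : K, complex.Im (nu x) != 0.

(* S contains exactly one embedding from each pair {nu, conj nu}. If K is totally
   real then nu = conj nu, so S is the set of all (real) embeddings. *)
Definition conj_transversal : Prop :=
  forall nu : emb R K,
    exists! mu : emb R K, mu \in S /\ (mu = nu \/ mu = conj_emb nu).

Definition sign_vec : Type := {mu : emb R K | mu \in S} -> int * int.

(* The pair of signs of the real and imaginary parts of a nonzero complex number
   tells which of the four open half-axes and four open quadrants contains it.
   For a totally real K the second component is always 0 and the first one is
   the sign of the image under the real place. *)
Definition sign (x : K) : sign_vec := fun mu =>
  (sgz (complex.Re (val mu x)), sgz (complex.Im (val mu x))).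

(* All vectors of signs +/- in the totally real case, the realized sign vectors
   in the totally complex case. *)
Definition mho : set sign_vec := [set theta |
  (totally_real /\ forall mu, theta mu = (1, 0) \/ theta mu = (-1, 0)) \/
  (totally_complex /\ exists2 x : K, x != 0 & theta = sign x)].

Definition Htheta (theta : sign_vec) : set (ell2 R K) :=
  [set F | forall x, F x != 0 -> x != 0 /\ sign x = theta].

Definition PHtheta (theta : sign_vec) : set (PH R K) :=
  [set cls F | F in [set F : nzvec R K | Htheta theta (val F)]].

Definition graded (u : PH R K -> PH R K) : Prop :=
  exists iota : sign_vec -> sign_vec, set_bij mho mho iota /\
    forall theta, mho theta -> u @` PHtheta theta = PHtheta (iota theta).

Definition FS_isometry (u : PH R K -> PH R K) : Prop :=
  forall x y, FS (u x) (u y) = FS x y.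

(* The last clause is an equality of partial values: a product of classes is
   defined iff the product of the images is, and then u preserves it. With this
   reading the set is closed under inverses. *)
Definition GalOplus_pred : {pred bijection (PH R K)} :=
  [pred u : bijection (PH R K) |
    `[< [/\ graded u,
            FS_isometry u,
            (forall x : K, u (proj_rho R x) = proj_rho R x) &
            (forall x y, omap u (proj_cauchy x y) = proj_cauchy (u x) (u y))] >]].

Lemma graded_inv (u : bijection (PH R K)) : graded u -> graded (bij_inv u).
Proof.
move=> [iota [[im inj surj] gu]].
have /choice[j jP] : forall theta, exists t, mho theta ->
    mho t /\ iota t = theta.
  move=> theta; have [h|nh] := pselect (mho theta); last by exists theta.
  by have [t ht <-] := surj _ h; exists t.
exists j; split; [split|].
- by move=> theta /jP[].
- by move=> a b /set_mem/jP[_ {2}<-] /set_mem/jP[_ {2}<-] ->.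
- move=> t ht; exists (iota t); first exact: im.
  have [h1 h2] := jP _ (im _ ht).
  by apply: inj h2; rewrite inE.
- move=> theta h; have [h1 h2] := jP _ h.
  rewrite -{1}h2 -gu // image_comp -[RHS]image_id.
  by apply: eq_imagel => x _ /=; rewrite bij_invK.
Qed.

Lemma GalOplus_closed : group_closed GalOplus_pred.
Proof.
split=> [|u v]; rewrite ?inE.
  split=> //; last by move=> x y; case: proj_cauchy.
  by exists id; split; [split=> // t; exists t|move=> theta _; exact: image_id].
move=> [gu iu fu cu] [/graded_inv gv iv fv cv]; have vK := bij_invKV v.
split.
- have [iota [bi hi]] := gu; have [j [bj hj]] := gv.
  exists (iota \o j); split; first exact: set_bij_comp bj bi.
  move=> theta h; rewrite -[RHS]hi; last by case: bj => + _ _; apply.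
  by rewrite -hj // image_comp.
- by move=> x y /=; rewrite iu -iv !vK.
- by move=> x /=; rewrite -[in X in _ (_ X) = _](fv x) bij_invK.
- move=> x y /=; rewrite -cu; set x' := bij_inv v x; set y' := bij_inv v y.
  rewrite -[x]vK -[y]vK -cv -/x' -/y'.
  by case: proj_cauchy => //= z; rewrite bij_invK.
Qed.

Record GalOplus := MkGalOplus {
  GalOplus_val :> bijection (PH R K);
  GalOplusP : GalOplus_val \in GalOplus_pred }.

HB.instance Definition _ := [isSub for GalOplus_val].
HB.instance Definition _ := [Choice of GalOplus by <:].
HB.instance Definition _ := SubChoice_isSubGroup.Build _ _ GalOplus GalOplus_closed.

End GaloisGroup.

(* Main.v *)
Require Import Defs.
From mathcomp Require Import all_boot all_order all_algebra all_field complex.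
From mathcomp Require Import boolp classical_sets functions reals.
From mathcomp Require Import ereal esum exp trigo.

Set Implicit Arguments.
Unset Strict Implicit.
Unset Printing Implicit Defensive.

Import Order.TTheory GRing.Theory Num.Theory.

Local Open Scope ring_scope.

(** The operator Phi_r is multiplication of coefficients by the function
    e_r(x) = exp(2 pi i Tr(x r)), which is unimodular and turns sums into
    products both in x ([expTr_addr]) and in r ([expTr_addl]). Everything except
    injectivity is formal. Unimodularity preserves the inner product and the
    norm, hence the Fubini-Study distance. Supports are unchanged, so every
    graded piece is mapped onto itself. A monomial rho^x is multiplied by the scalar e_r(x), so
    its class is fixed. The character property in x gives
    Phi_r F (+) Phi_r G = Phi_r (F (+) G), one side being defined exactly when
    the other is ([cauchy_prod_Phi]). The character property in r gives the
    homomorphism properties, and Phi_{-r} is the inverse of Phi_r.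

    For injectivity ([proj_Phi_inj]), suppose that Phi_r and Phi_s agree up to a
    scalar on the vector rho^0 + rho^x. The coefficient at 0 forces the scalar to
    be 1, and the coefficient at x then gives e_r(x) = e_s(x). So t = r - s
    satisfies e_t = 1 on all of K, i.e. Tr(x t) is an integer for every x in K.
    As K is divisible, applying this to x / n for large n shows Tr(x t) = 0
    ([Tr_eq0_of_expTr]). Thus the sum over nu of t_nu nu(x) vanishes identically,
    and the linear independence of distinct embeddings (Dedekind-Artin,
    [emb_independent]) gives t = 0. *)

(** * Linear independence of the embeddings *)

Section Independence.
Variables (R : realType) (K : fieldExtType rat).

(** Artin's argument, by induction on the size of the support: a relation whose
    support contains mu and another embedding yields a nonzero relation with
    smaller support, and a relation supported on {mu} is trivial, by evaluation
    at 1. *)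
Lemma emb_independent (c : emb R K -> R[i]) :
  (forall x, \sum_(nu : emb R K) nu x * c nu = 0) -> forall nu, c nu = 0.
Proof.
have [n] := ubnP #|[set nu | c nu != 0]|; elim: n c => // n IHn c cn c0 mu.
have [//|cmu] := eqVneq (c mu) 0.
have conc nu : c nu != 0 -> nu = mu.
  move=> cnu; apply: emb_eqP => a; apply/eqP; rewrite -subr_eq0.
  (* c' is again a relation; its support lies in that of c and omits mu. *)
  pose c' (nu : emb R K) := (nu a - mu a) * c nu.
  suff /(_ nu)/eqP : forall nu, c' nu = 0 by rewrite mulf_eq0 (negPf cnu) orbF.
  apply: IHn => [|x].
    rewrite ltnS in cn; apply: leq_trans cn; apply: proper_card.
    apply/properP; split.
      by apply/fintype.subsetP => k; rewrite !inE mulf_eq0 negb_or => /andP[].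
    by exists mu; rewrite !inE // /c' subrr mul0r eqxx.
  transitivity (\sum_(nu : emb R K) nu (x * a) * c nu -
                mu a * \sum_(nu : emb R K) nu x * c nu).
    rewrite mulr_sumr -sumrB; apply: eq_bigr => k _.
    by rewrite /c' rmorphM /= mulrBl mulrBr !mulrA [mu a * _]mulrC.
  by rewrite !c0 mulr0 subrr.
have := c0 1; rewrite (bigD1 mu) //= rmorph1 mul1r big1 ?addr0 // => nu nmu.
by rewrite (_ : c nu = 0) ?mulr0 //; apply: contraNeq nmu => /conc ->.
Qed.

End Independence.

(** * The characters x |-> exp(2 pi i Tr(x r)) of K *)

Section Character.
Variables (R : realType) (K : fieldExtType rat).
Implicit Types (r s : Kinf R K) (x y : K).

Lemma TrD r s : Tr (r + s) = Tr r + Tr s.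
Proof. by apply: (@complexI R); rewrite [RHS]rmorphD /= !TrE -big_split. Qed.

Lemma KdiagD x y : Kdiag R (x + y) = Kdiag R x + Kdiag R y.
Proof. by apply: val_inj; apply/funext => nu; exact: (rmorphD nu). Qed.

Lemma Tr_addl r s x :
  Tr (Kdiag R x * (r + s)) = Tr (Kdiag R x * r) + Tr (Kdiag R x * s).
Proof. by rewrite mulrDr TrD. Qed.

Lemma Tr_addr r x y :
  Tr (Kdiag R (x + y) * r) = Tr (Kdiag R x * r) + Tr (Kdiag R y * r).
Proof. by rewrite KdiagD mulrDl TrD. Qed.

Lemma Tr_mulrn r x n : Tr (Kdiag R (x *+ n) * r) = Tr (Kdiag R x * r) *+ n.
Proof.
elim: n => [|n IHn]; last by rewrite !mulrS Tr_addr IHn.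
by apply: (addrI (Tr (Kdiag R x * r))); rewrite -Tr_addr !mulr0n !addr0.
Qed.

Lemma cexp_imE (t : R) : cexp (t%:C * 'i)%C = (cos t +i* sin t)%C.
Proof.
by rewrite /cexp /= !mul0r mulr0 mulr1 subrr addr0 expR0 mul1r.
Qed.

Lemma cexp_imD (s t : R) :
  cexp ((s + t)%:C * 'i)%C = cexp (s%:C * 'i)%C * cexp (t%:C * 'i)%C.
Proof. by rewrite !cexp_imE cosD sinD; congr (_ +i* _)%C; rewrite addrC. Qed.

Lemma expTr_addl r s x : expTr (r + s) x = expTr r x * expTr s x.
Proof. by rewrite /expTr Tr_addl mulrDr cexp_imD. Qed.

Lemma expTr_addr r x y : expTr r (x + y) = expTr r x * expTr r y.
Proof. by rewrite /expTr Tr_addr mulrDr cexp_imD. Qed.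

Lemma normc_expTr r x : Normc.normc (expTr r x) = 1.
Proof. exact: normc_cexpi. Qed.

Lemma expTr_neq0 r x : expTr r x != 0.
Proof.
apply/eqP => e0; have := normc_expTr r x; rewrite e0 Normc.normc0 => /esym/eqP.
by rewrite oner_eq0.
Qed.

Lemma expTr_r0 r : expTr r 0 = 1.
Proof.
apply: (mulfI (expTr_neq0 r 0)).
by rewrite mulr1 -expTr_addr addr0.
Qed.

Lemma expTr_0l x : expTr (0 : Kinf R K) x = 1.
Proof.
apply: (mulfI (expTr_neq0 0 x)).
by rewrite mulr1 -expTr_addl addr0.
Qed.

Lemma expTr_conj r x : expTr r x * conjc (expTr r x) = 1.
Proof.
rewrite /expTr cexp_imE; set t := 2 * pi * _.
by rewrite -[RHS](complexr0 1) //; congr (_ +i* _)%C;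
  rewrite ?mulrN ?opprK -?expr2 ?cos2Dsin2 // mulrC addNr.
Qed.

Lemma cos_eq1_small (t : R) : `|t| <= pi -> cos t = 1 -> t = 0.
Proof.
move=> tpi ct; apply/normr0_eq0; apply: cos_inj.
- by rewrite in_itv /= normr_ge0.
- by rewrite in_itv /= lexx pi_ge0.
- by rewrite cos0 -ct cos_norm.
Qed.

(** The additive map x |-> Tr(x r) takes integral values on a divisible group,
    so it vanishes. *)
Lemma Tr_eq0_of_expTr r : (forall x, expTr r x = 1) ->
  forall x, Tr (Kdiag R x * r) = 0.
Proof.
move=> e1 x; set T := Tr _.
(* With y = x / n, the angle 2 pi Tr(y r) = 2 pi T / n is at most pi. *)
pose n := (Num.bound `|2 * T|).+1; pose y : K := x / n%:R.
have nK : n%:R != 0 :> K.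
  have /pcharf0P -> // : [pchar K] =i pred0.
  by move=> p; rewrite pchar_lalg pchar_num.
have Ty : T = Tr (Kdiag R y * r) *+ n by rewrite -Tr_mulrn -mulr_natr divfK.
move: Ty (e1 y); rewrite /expTr cexp_imE; set t := Tr _ => Ty [c1 _].
suff t0 : 2 * pi * t = 0.
  have : (2 * pi) * t == 0 by rewrite t0.
  rewrite !mulf_eq0 pnatr_eq0 /= (gt_eqF (pi_gt0 R)) /= => /eqP t00.
  by rewrite Ty t00 mul0rn.
apply: cos_eq1_small => //.
have t1 : `|2 * t| <= 1.
  have n0 : 0 < n%:R :> R by rewrite ltr0n.
  rewrite -(ler_pM2r n0) mul1r -{1}[n%:R]ger0_norm ?ler0n // -normrM.
  rewrite -mulrA mulr_natr -Ty.
  apply: ltW; apply: lt_le_trans (archi_boundP (normr_ge0 _)) _.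
  by rewrite ler_nat leqnSn.
by rewrite mulrAC normrM [`|pi|]ger0_norm ?pi_ge0 // ler_piMl ?pi_ge0.
Qed.

(** The trace pairing of [Kinf] with K has no kernel on the side of [Kinf], so r
    is determined by its character. *)
Lemma expTr_injective r s : (forall x, expTr r x = expTr s x) -> r = s.
Proof.
move=> rs; apply/eqP; rewrite -subr_eq0; apply/eqP.
have e1 x : expTr (r - s) x = 1.
  by apply: (mulIf (expTr_neq0 s x)); rewrite -expTr_addl subrK mul1r.
apply: val_inj; apply/funext => nu.
apply: (@emb_independent R K (val (r - s))) => x.
by rewrite -(TrE (Kdiag R x * (r - s))) Tr_eq0_of_expTr.
Qed.

End Character.

(** * The unitary representation *)

(* From here on only the character properties, unimodularity and injectivity of
   [expTr] are used, never its definition. *)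
Local Opaque expTr.

Section Action.
Variables (R : realType) (K : fieldExtType rat).
Local Notation H := (ell2 R K).
Implicit Types (r s : Kinf R K) (F G : H).

Lemma Phi_comp r s F : Phi r (Phi s F) = Phi (r + s) F.
Proof.
apply: val_inj; apply/funext => x /=.
by rewrite expTr_addl -mulrA [expTr s x * _]mulrC.
Qed.

Lemma Phi_0 F : Phi 0 F = F.
Proof. by apply: val_inj; apply/funext => x /=; rewrite expTr_0l mulr1. Qed.

Lemma PhiK r : cancel (Phi r) (@Phi R K (- r)).
Proof. by move=> F; rewrite Phi_comp addNr Phi_0. Qed.

Lemma PhiVK r : cancel (@Phi R K (- r)) (Phi r).
Proof. by move=> F; rewrite Phi_comp addrN Phi_0. Qed.

Lemma Phi_linear r : linear (@Phi R K r).
Proof.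
move=> a F G; apply: val_inj; apply/funext => x.
transitivity ((a * F x + G x) * expTr r x) => //.
by rewrite mulrDl -mulrA.
Qed.

Lemma inner_Phi r F G : inner (Phi r F) (Phi r G) = inner F G.
Proof.
rewrite /inner; congr csum; apply/funext => x /=.
by rewrite rmorphM /= mulrACA expTr_conj mulr1.
Qed.

Lemma hnorm_Phi r F : hnorm (Phi r F) = hnorm F.
Proof.
rewrite /hnorm; congr (Num.sqrt (fine _)); apply: eq_esum => x _ /=.
by rewrite Normc.normcM normc_expTr mulr1.
Qed.

Lemma Phi_rho r x : Phi r (rho R x) = expTr r x *: rho R x.
Proof.
apply: val_inj; apply/funext => y.
transitivity ((y == x)%:R * expTr r y) => //.
transitivity (expTr r x * (y == x)%:R) => //.
by case: (eqVneq y x) => [->|_]; rewrite ?mulr1 ?mul1r ?mulr0 ?mul0r.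
Qed.

Lemma cauchy_coef_Phi r F G :
  cauchy_coef (Phi r F) (Phi r G) = fun x => cauchy_coef F G x * expTr r x.
Proof.
apply/funext => x; rewrite [RHS]mulrC /cauchy_coef -csumZ; congr csum.
apply/funext => y /=; have := expTr_addr r y (x - y).
by rewrite subrKC => ->; rewrite [LHS]mulrACA [LHS]mulrC.
Qed.

Lemma cauchy_prod_Phi r F G :
  cauchy_prod (Phi r F) (Phi r G) = omap (Phi r) (cauchy_prod F G).
Proof.
rewrite /cauchy_prod cauchy_coef_Phi.
case: (insubP _ (cauchy_coef F G)) => [E _ EE|nE] /=.
  by rewrite -EE (_ : (fun x => _) = val (Phi r E)) // valK.
(* If the twisted sequence is square-summable, untwisting it by - r shows that
   cauchy_coef F G is square-summable too. *)
rewrite insubF //; apply: contraNF nE => nE.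
have -> : cauchy_coef F G = val (Phi (- r) (MkEll2 nE)).
  apply/funext => x /=.
  by rewrite -mulrA -expTr_addl addrN expTr_0l mulr1.
exact: coefP.
Qed.

Definition Phi_bij r : bijection H :=
  MkBijection (Bijective (PhiK r) (PhiVK r)).

Lemma Phi_unitary_subproof r : Phi_bij r \in @unitary_pred R K.
Proof.
by rewrite inE; split; [exact: Phi_linear|exact: inner_Phi].
Qed.

(** Phi_r as an element of the unitary group. *)
Definition Phi_unitary r : unitary R K := MkUnitary (Phi_unitary_subproof r).

Lemma Phi_unitaryD : {morph Phi_unitary : r s / r + s >-> (r * s)%g}.
Proof.
by move=> r s; apply: val_inj; apply: bijection_eqP => F; rewrite /= Phi_comp.
Qed.

(** * The projectivized action *)

Local Notation P r := (projectivize (Phi_unitary r)).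

Lemma cls_surj (x : PH R K) : exists F : nzvec R K, x = cls F.
Proof. by exists (repr x); rewrite /cls reprK. Qed.

Lemma proj_Phi_comp r s x : P r (P s x) = P (r + s) x.
Proof.
have [F ->] := cls_surj x; rewrite !projectivizeE; congr cls.
by apply: val_inj; rewrite /= Phi_comp.
Qed.

Lemma proj_Phi_0 x : P 0 x = x.
Proof.
have [F ->] := cls_surj x; rewrite !projectivizeE; congr cls.
by apply: val_inj; rewrite /= Phi_0.
Qed.

Lemma proj_PhiK r : cancel (P r) (P (- r)).
Proof. by move=> x; rewrite proj_Phi_comp addNr proj_Phi_0. Qed.

Lemma proj_PhiVK r : cancel (P (- r)) (P r).
Proof. by move=> x; rewrite proj_Phi_comp addrN proj_Phi_0. Qed.

Definition proj_Phi_bij r : bijection (PH R K) :=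
  MkBijection (Bijective (proj_PhiK r) (proj_PhiVK r)).

Lemma proj_Phi_FS r : FS_isometry (P r).
Proof.
move=> x y; have [F ->] := cls_surj x; have [G ->] := cls_surj y.
by rewrite !projectivizeE !FS_cls /= inner_Phi !hnorm_Phi.
Qed.

Lemma proj_Phi_rho r x : P r (proj_rho R x) = proj_rho R x.
Proof.
rewrite /proj_rho projectivizeE; apply/clsP.
by exists (expTr r x); rewrite ?expTr_neq0 //= Phi_rho.
Qed.

Lemma proj_Phi_cauchy r x y :
  omap (P r) (proj_cauchy x y) = proj_cauchy (P r x) (P r y).
Proof.
have [F ->] := cls_surj x; have [G ->] := cls_surj y.
rewrite !projectivizeE !proj_cauchy_cls /= cauchy_prod_Phi.
case: cauchy_prod => //= E.
case: insubP => [E1 _ EE|/negPn/eqP ->] /=.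
  rewrite -EE -[Phi r _]/(val (unitary_nz (Phi_unitary r) E1)) valK /=.
  by rewrite projectivizeE.
by rewrite -[Phi r 0]/(Phi_unitary r 0) unitary0 insubF ?eqxx.
Qed.

Lemma proj_Phi_PHtheta r (S : {set emb R K}) (theta : sign_vec S) x :
  PHtheta theta x -> PHtheta theta (P r x).
Proof.
move=> [F hF <-]; rewrite projectivizeE.
exists (unitary_nz (Phi_unitary r) F) => //.
by move=> y /=; rewrite mulf_eq0 negb_or => /andP[/hF].
Qed.

(** Each graded piece is preserved: the permutation of the signs is trivial. *)
Lemma proj_Phi_graded r (S : {set emb R K}) : graded S (P r).
Proof.
exists id; split; first by split=> // t; exists t.
move=> theta _; apply/seteqP; split=> [_ [x hx <-]|x hx].
  exact: proj_Phi_PHtheta.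
by exists (P (- r) x); [exact: proj_Phi_PHtheta|exact: proj_PhiVK].
Qed.

Lemma proj_Phi_Gal_subproof r (S : {set emb R K}) :
  proj_Phi_bij r \in GalOplus_pred S.
Proof.
rewrite inE; split.
- exact: proj_Phi_graded.
- exact: proj_Phi_FS.
- exact: proj_Phi_rho.
- exact: proj_Phi_cauchy.
Qed.

(** The class of Phi_r in the Galois group. *)
Definition proj_Phi_Gal (S : {set emb R K}) r : GalOplus S :=
  MkGalOplus (proj_Phi_Gal_subproof r S).

Lemma proj_Phi_GalD (S : {set emb R K}) :
  {morph proj_Phi_Gal S : r s / r + s >-> (r * s)%g}.
Proof.
move=> r s; apply: val_inj; apply: bijection_eqP => x.
by rewrite /= proj_Phi_comp.
Qed.

Lemma proj_Phi_inj r s : P r =1 P s -> r = s.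
Proof.
move=> rs; apply: expTr_injective => x.
(* The coefficients of F at 0 and at x are nonzero, also when x = 0, where both
   equal 2. *)
pose F : H := rho R 0 + rho R x.
have Fcoef y : F y = ((y == 0) + (y == x))%:R by rewrite natrD.
have F00 : F 0 != 0 by rewrite Fcoef eqxx pnatr_eq0.
have Fx0 : F x != 0 by rewrite Fcoef eqxx addn1 pnatr_eq0.
have F0 : F != 0 by apply: contraNneq F00 => ->.
have := rs (cls (exist _ F F0)); rewrite !projectivizeE => /clsP[c _ /= E].
have Ey y : F y * expTr r y = c * (F y * expTr s y).
  exact: (congr1 (fun G : H => G y) E).
have c1 : c = 1.
  by apply: (mulIf F00); have := Ey 0; rewrite !expTr_r0 !mulr1 mul1r.
by apply: (mulfI Fx0); rewrite Ey c1 mul1r.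
Qed.

End Action.

Theorem proposition4 (R : realType) (K : splittingFieldType rat)
    (galK : galois 1%VS {:K}%VS)
    (S : {set emb R K}) (transvS : conj_transversal S) :
  exists U : Kinf R K -> unitary R K,
    [/\ forall (r : Kinf R K) (F : ell2 R K), U r F = Phi r F,
        {morph U : r s / r + s >-> (r * s)%g} &
        exists PU : Kinf R K -> GalOplus S,
          [/\ forall (r : Kinf R K) (x : PH R K), PU r x = projectivize (U r) x,
              {morph PU : r s / r + s >-> (r * s)%g} &
              injective PU]].
Proof.
exists (@Phi_unitary R K); split=> //; first exact: Phi_unitaryD.
exists (proj_Phi_Gal S); split=> //; first exact: proj_Phi_GalD.
move=> r s rs; apply: proj_Phi_inj => x.
exact: (congr1 (fun u : GalOplus S => u x) rs).
Qed.
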